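(* In an augmented virtual double category $\mathcal K$ let $d\colon A\to M$, $j\colon A\to B$ and $l\colon B\to M$ be vertical morphisms and let $\eta\colon d\Rightarrow l\circ j$ be a vertical cell. Assume that the companion $j_*\colon A\nrightarrow B$ of $j$ exists, and let $\eta'\colon j_*\Rightarrow M$, with vertical source $d$ and vertical target $l$, be the unique factorisation $\eta=\eta'\circ\mathrm{cocart}$ of $\eta$ through the weakly cocartesian cell $\mathrm{cocart}\colon(A)\Rightarrow j_*$ (with vertical source $\mathrm{id}_A$ and vertical target $j$) that defines $j_*$. The vertical cell $\eta$ defines $l$ as the left Kan extension of $d$ along $j$ in the $2$-category $V(\mathcal K)$ precisely if $\eta'$ defines $l$ as the weak left Kan extension of $d$ along $j_*$ in $\mathcal K$.
   Context: **Augmented virtual double category** $\mathcal K$: it consists of objects; a category of vertical morphisms $f\colon A\to C$ between these objects; horizontal morphisms $J\colon A\nrightarrow B$ between objects; and cells. A cell $\phi\colon\underline J\Rightarrow\underline K$ has a horizontal source $\underline J=(J_1,\dotsc,J_n)$, a path $J_i\colon A_{i-1}\nrightarrow A_i$ of length $n\ge0$ (the empty path at $A_0$ is written $(A_0)$); a horizontal target $\underline K$, a path from $C$ to $D$ of length at most $1$ (so $\underline K=K\colon C\nrightarrow D$, or $\underline K=(C)$ with $C=D$, also written $\phi\colon\underline J\Rightarrow C$); a vertical source $f\colon A_0\to C$ and a vertical target $g\colon A_n\to D$. It is unary if $\underline K$ has length $1$, nullary if $\underline K$ has length $0$, vertical if $\underline J$ and $\underline K$ are both empty (written $\phi\colon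 f\Rightarrow g$), horizontal if $f$ and $g$ are identities. Given $n\ge1$ cells $\phi_i\colon\underline J_i\Rightarrow\underline K_i$, the vertical target of each being the vertical source of the next, and a cell $\psi\colon\underline K_1\frown\dotsb\frown\underline K_n\Rightarrow\underline L$ ($\frown$ denotes concatenation), there is a composite $\psi\circ(\phi_1,\dotsc,\phi_n)\colon\underline J_1\frown\dotsb\frown\underline J_n\Rightarrow\underline L$ whose vertical source (target) is that of $\psi$ composed with that of $\phi_1$ ($\phi_n$). There are identity cells $\mathrm{id}_J\colon J\Rightarrow J$ (horizontal) and $\mathrm{id}_f\colon f\Rightarrow f$ (vertical), with $\mathrm{id}_h\circ(\mathrm{id}_f)=\mathrm{id}_{h\circ f}$; $\mathrm{id}_A:=\mathrm{id}_{\mathrm{id}_A}$. Axioms: $\chi\circ(\psi_1\circ(\phi_{11},\dotsc,\phi_{1m_1}),\dotsc,\psi_n\circ(\phi_{n1},\dotsc,\phi_{nm_n}))=(\chi\circ(\psi_1,\dotsc,\psi_n))\circ(\phi_{11},\dotsc,\phi_{nm_n})$ whenever the left-hand side makes sense; $\mathrm{id}_C\circ(\phi)=\phi$, $\mathrm{id}_K\circ(\phi)=\phi$, $\phi\circ(\mathrm{id}_A)=\phi$, $\phi\circ(\mathrm{id}_{J_1},\dotsc,\mathrm{id}_{J_n})=\phi$ and $\psi\circ(\phi_1,\dotsc,\phi_i,\mathrm{id}_{f_i},\phi_{i+1},\dotsc,\phi_n)=\psi\circ(\phi_1,\dotsc,\phi_n)$ whenever these make sense. Notation: $h\circ\phi:=\mathrm{id}_h\circ(\phi)$,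 $\psi\circ f:=\psi\circ(\mathrm{id}_f)$; for adjacent cells $\phi\colon\underline J\Rightarrow\underline K$, $\psi\colon\underline H\Rightarrow\underline L$ with $\underline K\frown\underline L$ of length $\le1$, $\phi\odot\psi:=\mathrm{id}_{\underline K\frown\underline L}\circ(\phi,\psi)$, where $\mathrm{id}_{(C)}$ means $\mathrm{id}_C$. $V(\mathcal K)$ is the $2$-category of objects, vertical morphisms and vertical cells of $\mathcal K$, with $\odot$ as composition of $2$-cells. **Companions.** A cell $\psi\colon\underline J\Rightarrow\underline K$ with $\underline J$ of length $\le1$, vertical source $f$ and target $g$, is cartesian if every cell $\chi\colon\underline H\Rightarrow\underline K$ with vertical source $f\circ h$ and target $g\circ k$ factors uniquely as $\chi=\psi\circ\phi$ with $\phi\colon\underline H\Rightarrow\underline J$ having vertical source $h$ and target $k$. A unary cell $\phi\colon\underline J\Rightarrow K$ with vertical source $f$ and target $g$ is weakly cocartesian if every cell $\chi\colon\underline J\Rightarrow\underline L$ with vertical source $h\circ f$ and target $k\circ g$ factors uniquely as $\chi=\psi\circ\phi$ with $\psi\colon K\Rightarrow\underline L$ having vertical source $h$ and target $k$. The companion $j_*\colon A\nrightarrow B$ of $j\colon A\to B$ is defined by a cartesian cell $\mathrm{cart}\colon j_*\Rightarrow B$ with vertical source $j$ and target $\mathrm{id}_B$; corresponding to it is a unique weakly cocartesian cell $\mathrm{cocart}\colon(A)\Rightarrow j_*$, with vertical source $\mathrm{id}_A$ and target $j$, such that $\mathrm{cart}\circ\mathrm{cocart}=\mathrm{id}_j$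 and $\mathrm{cocart}\odot\mathrm{cart}=\mathrm{id}_{j_*}$. **Weak left Kan extension.** A nullary cell $\eta\colon(J_1,\dotsc,J_n)\Rightarrow M$ with vertical source $d\colon A_0\to M$ and target $l\colon A_n\to M$ defines $l$ as the weak left Kan extension of $d$ along $(J_1,\dotsc,J_n)$ if every nullary cell $\phi\colon(J_1,\dotsc,J_n)\Rightarrow M$ with vertical source $d$ and any vertical target $k\colon A_n\to M$ factors uniquely as $\phi=\eta\odot\phi'$ with $\phi'\colon l\Rightarrow k$ a vertical cell. *)

(* Defs.v *)
From Corelib Require Import ssreflect ssrfun ssrbool.
From Stdlib Require Import Eqdep.

Set Implicit Arguments.
Unset Strict Implicit.
Unset Printing Implicit Defensive.

(** * Paths of horizontal morphisms *)

Section Paths.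
Variables (T : Type) (H : T -> T -> Type).

Inductive path : T -> T -> Type :=
| pnil (A : T) : path A A
| pcons (A B C : T) (J : H A B) (Js : path B C) : path A C.

(* paths of length at most 1 *)
Inductive path1 : T -> T -> Type :=
| P0 (A : T) : path1 A A
| P1 (A B : T) (J : H A B) : path1 A B.

Definition path_of (A B : T) (K : path1 A B) : path A B :=
  match K with
  | P0 A => pnil A
  | P1 J => pcons J (pnil _)
  end.

Fixpoint pcat (A B C : T) (J : path A B) : path B C -> path A C :=
  match J with
  | pnil _ => fun K => K
  | pcons J1 Js => fun K => pcons J1 (pcat Js K)
  end.

Lemma pcatA (A B C D : T) (J : path A B) (K : path B C) (L : path C D) :
  pcat J (pcat K L) = pcat (pcat J K) L.
Proof. by elim: J K => [//|X Y Z J1 Js IH] K /=; rewrite IH. Qed.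

End Paths.

Arguments pnil {T H} A.
Arguments P0 {T H} A.
Arguments P1 {T H A B} J.
Coercion path_of : path1 >-> path.
Notation "J +++ K" := (pcat J K) (at level 60, right associativity).

(** * Augmented virtual double categories *)

(* [vcomp g f] is the composite of [f] followed by [g]. *)
Record avd_graph := AvdGraph {
  ob :> Type;
  ver : ob -> ob -> Type;
  vid : forall A, ver A A;
  vcomp : forall A B C, ver B C -> ver A B -> ver A C;
  vcompA : forall A B C D (h : ver C D) (g : ver B C) (f : ver A B),
    vcomp h (vcomp g f) = vcomp (vcomp h g) f;
  vcomp_idl : forall A B (f : ver A B), vcomp (vid B) f = f;
  vcomp_idr : forall A B (f : ver A B), vcomp f (vid A) = f;
  hor : ob -> ob -> Type;
  cell : forall A B C D, path hor A B -> path1 hor C D ->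
    ver A C -> ver B D -> Type
}.

Arguments ver {a}.
Arguments vid {a}.
Arguments vcomp {a A B C}.
Arguments hor {a}.
Arguments cell {a A B C D}.
Notation "g \oo f" := (vcomp g f) (at level 40, left associativity).

Section Chains.
Variable G : avd_graph.
Implicit Types A B C D E F : G.

(* Equality of cells whose boundaries need not be convertible (for instance
   because they differ by associativity of [vcomp]): the boundaries are equal
   and, along this equality, so are the cells. *)
Inductive cell_eq A B C D (J : path hor A B) (K : path1 hor C D)
    (f : ver A C) (g : ver B D) (phi : cell J K f g) :
  forall (J' : path hor A B) (K' : path1 hor C D)
    (f' : ver A C) (g' : ver B D), cell J' K' f' g' -> Prop :=
| cell_eq_refl : cell_eq phi phi.

(* [chain J K f g]: sequences (phi_1, ..., phi_n), n >= 1, of cells such that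
   the vertical target of each is the vertical source of the next; J and K are
   the concatenated horizontal sources and targets, f is the vertical source of
   phi_1 and g the vertical target of phi_n. *)
Inductive chain : forall A B C D, path (@hor G) A B -> path (@hor G) C D ->
    ver A C -> ver B D -> Type :=
| chain1 A B C D (J : path hor A B) (K : path1 hor C D)
    (f : ver A C) (g : ver B D) :
    cell J K f g -> chain J K f g
| chain_cons A B X C D Y (J1 : path hor A X) (K1 : path1 hor C Y)
    (J2 : path hor X B) (K2 : path hor Y D)
    (f : ver A C) (g : ver X Y) (h : ver B D) :
    cell J1 K1 f g -> chain J2 K2 g h -> chain (J1 +++ J2) (K1 +++ K2) f h.

Definition chain_cast A B C D (J J' : path hor A B) (K K' : path hor C D)
    (f : ver A C) (g : ver B D) (eJ : J = J') (eK : K = K')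
    (Phi : chain J K f g) : chain J' K' f g :=
  match eJ in _ = J0, eK in _ = K0 return chain J0 K0 f g with
  | eq_refl, eq_refl => Phi
  end.

Fixpoint chain_cat A B X C D Y (J1 : path hor A X) (K1 : path hor C Y)
    (f : ver A C) (g : ver X Y) (Phi : chain J1 K1 f g) :
  forall (J2 : path hor X B) (K2 : path hor Y D) (h : ver B D),
    chain J2 K2 g h -> chain (J1 +++ J2) (K1 +++ K2) f h :=
  match Phi in @chain A X C Y J1 K1 f g
    return forall (J2 : path hor X B) (K2 : path hor Y D) (h : ver B D),
      chain J2 K2 g h -> chain (J1 +++ J2) (K1 +++ K2) f h with
  | chain1 phi => fun J2 K2 h Psi => chain_cons phi Psi
  | chain_cons phi Phi' => fun J2 K2 h Psi =>
      chain_cast (pcatA _ _ _) (pcatA _ _ _)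
        (chain_cons phi (chain_cat Phi' Psi))
  end.

(* [chain_insert_id Phi Phi']: Phi' is obtained from Phi by inserting one
   vertical identity cell, at the start, at the end, or between two cells. *)
Inductive chain_insert_id (idv : forall A C (f : ver A C),
      cell (pnil A) (P0 C) f f) :
  forall A B C D (J J' : path hor A B) (K K' : path hor C D)
    (f : ver A C) (g : ver B D), chain J K f g -> chain J' K' f g -> Prop :=
| insert_start A B C D (J : path hor A B) (K : path hor C D)
    (f : ver A C) (g : ver B D) (Phi : chain J K f g) :
    chain_insert_id idv Phi (chain_cons (idv A C f) Phi)
| insert_end A B C D (J : path hor A B) (K : path1 hor C D)
    (f : ver A C) (g : ver B D) (phi : cell J K f g) :
    chain_insert_id idv (chain1 phi) (chain_cons phi (chain1 (idv B D g)))
| insert_cons A B X C D Y (J1 : path hor A X) (K1 : path1 hor C Y)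
    (J2 J2' : path hor X B) (K2 K2' : path hor Y D)
    (f : ver A C) (g : ver X Y) (h : ver B D) (phi : cell J1 K1 f g)
    (Phi : chain J2 K2 g h) (Phi' : chain J2' K2' g h) :
    chain_insert_id idv Phi Phi' ->
    chain_insert_id idv (chain_cons phi Phi) (chain_cons phi Phi').

(* The chain (id_{J_1}, ..., id_{J_n}), n >= 1. *)
Fixpoint chain_idh (idh : forall A B (J : hor A B),
      cell (P1 J) (P1 J) (vid A) (vid B))
    A X B (J : hor A X) (Js : path hor X B) :
  chain (pcons J Js) (pcons J Js) (vid A) (vid B) :=
  match Js in path _ X B return forall J : hor A X,
    chain (pcons J Js) (pcons J Js) (vid A) (vid B) with
  | pnil _ => fun J => chain1 (idh _ _ J)
  | pcons J2 Js' => fun J => chain_cons (idh _ _ J) (chain_idh idh J2 Js')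
  end J.

(* A two-level pasting scheme: cells psi_1, ..., psi_n (n >= 1) and, above each
   psi_i, a nonempty chain (phi_i1, ..., phi_im_i) with which it composes. *)
Inductive stack : forall A B C D E F, path (@hor G) A B -> path (@hor G) C D ->
    path (@hor G) E F -> ver A C -> ver B D -> ver C E -> ver D F -> Type :=
| stack1 A B C D E F (J : path hor A B) (K : path hor C D) (L : path1 hor E F)
    (f : ver A C) (g : ver B D) (h : ver C E) (k : ver D F) :
    chain J K f g -> cell K L h k -> stack J K L f g h k
| stack_cons A X B C Y D E Z F
    (J1 : path hor A X) (K1 : path hor C Y) (L1 : path1 hor E Z)
    (J2 : path hor X B) (K2 : path hor Y D) (L2 : path hor Z F)
    (f : ver A C) (f' : ver X Y) (f'' : ver B D)
    (h : ver C E) (h' : ver Y Z) (h'' : ver D F) :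
    chain J1 K1 f f' -> cell K1 L1 h h' -> stack J2 K2 L2 f' f'' h' h'' ->
    stack (J1 +++ J2) (K1 +++ K2) (L1 +++ L2) f f'' h h''.

(* (phi_11, ..., phi_nm_n) *)
Fixpoint stack_top A B C D E F (J : path hor A B) (K : path hor C D)
    (L : path hor E F) (f : ver A C) (g : ver B D) (h : ver C E) (k : ver D F)
    (S : stack J K L f g h k) : chain J K f g :=
  match S with
  | stack1 Phi _ => Phi
  | stack_cons Phi _ S' => chain_cat Phi (stack_top S')
  end.

(* (psi_1, ..., psi_n) *)
Fixpoint stack_bottom A B C D E F (J : path hor A B) (K : path hor C D)
    (L : path hor E F) (f : ver A C) (g : ver B D) (h : ver C E) (k : ver D F)
    (S : stack J K L f g h k) : chain K L h k :=
  match S with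
  | stack1 _ psi => chain1 psi
  | stack_cons _ psi S' => chain_cons psi (stack_bottom S')
  end.

Definition composition := forall A B C D E F (J : path (@hor G) A B)
    (K : path (@hor G) C D) (L : path1 (@hor G) E F)
    (f : ver A C) (g : ver B D) (h : ver C E) (k : ver D F),
  cell K L h k -> chain J K f g -> cell J L (h \oo f) (k \oo g).

(* (psi_1 o (phi_11, ..., phi_1m_1), ..., psi_n o (phi_n1, ..., phi_nm_n)) *)
Fixpoint stack_comp (comp : composition)
    A B C D E F (J : path hor A B) (K : path hor C D)
    (L : path hor E F) (f : ver A C) (g : ver B D) (h : ver C E) (k : ver D F)
    (S : stack J K L f g h k) : chain J L (h \oo f) (k \oo g) :=
  match S with
  | stack1 Phi psi => chain1 (comp _ _ _ _ _ _ _ _ _ _ _ _ _ psi Phi)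
  | stack_cons Phi psi S' =>
      chain_cons (comp _ _ _ _ _ _ _ _ _ _ _ _ _ psi Phi) (stack_comp comp S')
  end.

End Chains.

Record avdc := Avdc {
  avdc_graph :> avd_graph;
  comp : composition avdc_graph;
  idh : forall (A B : avdc_graph) (J : hor A B),
    cell (P1 J) (P1 J) (vid A) (vid B);
  idv : forall (A C : avdc_graph) (f : ver A C), cell (pnil A) (P0 C) f f;
  idv_comp : forall (A C E : avdc_graph) (h : ver C E) (f : ver A C),
    comp (idv h) (chain1 (idv f)) = idv (h \oo f);
  compA : forall (A B C D E F X Y : avdc_graph) (J : path hor A B)
      (K : path hor C D) (L : path hor E F) (M : path1 hor X Y)
      (f : ver A C) (g : ver B D) (h : ver C E) (k : ver D F)
      (p : ver E X) (q : ver F Y)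
      (chi : cell L M p q) (S : stack J K L f g h k),
    cell_eq (comp chi (stack_comp comp S))
            (comp (comp chi (stack_bottom S)) (stack_top S));
  comp_idvl : forall (A B C : avdc_graph) (J : path hor A B)
      (f : ver A C) (g : ver B C) (phi : cell J (P0 C) f g),
    cell_eq (comp (idv (vid C)) (chain1 phi)) phi;
  comp_idhl : forall (A B C D : avdc_graph) (J : path hor A B) (K : hor C D)
      (f : ver A C) (g : ver B D) (phi : cell J (P1 K) f g),
    cell_eq (comp (idh K) (chain1 phi)) phi;
  comp_idvr : forall (A C D : avdc_graph) (K : path1 hor C D)
      (f : ver A C) (g : ver A D) (phi : cell (pnil A) K f g),
    cell_eq (comp phi (chain1 (idv (vid A)))) phi;
  comp_idhr : forall (A X B C D : avdc_graph) (J : hor A X) (Js : path hor X B)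
      (K : path1 hor C D) (f : ver A C) (g : ver B D)
      (phi : cell (pcons J Js) K f g),
    cell_eq (comp phi (chain_idh idh J Js)) phi;
  (* [psi] and [psi'] are the same cell; their horizontal sources differ by
     the insertion of an empty path *)
  comp_insert_id : forall (A B C D E F : avdc_graph) (J J' : path hor A B)
      (K K' : path hor C D) (L : path1 hor E F)
      (f : ver A C) (g : ver B D) (h : ver C E) (k : ver D F)
      (Phi : chain J K f g) (Phi' : chain J' K' f g)
      (psi : cell K L h k) (psi' : cell K' L h k),
    chain_insert_id idv Phi Phi' -> cell_eq psi' psi ->
    cell_eq (comp psi' Phi') (comp psi Phi)
}.

Arguments comp {a A B C D E F J K L f g h k}.
Arguments idh {a A B} J.
Arguments idv {a A C} f.

Section Notions.
Variable K : avdc.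
Implicit Types A B C D E F M : K.

Definition vcell A C (f g : ver A C) := cell (pnil A) (P0 C) f g.

Definition id1 C D (L : path1 hor C D) : cell L L (vid C) (vid D) :=
  match L with
  | P0 C => idv (vid C)
  | P1 J => idh J
  end.

(* phi (.) psi with phi nullary *)
Definition odot A X B C D (J : path hor A X) (H : path hor X B)
    (L : path1 hor C D) (f : ver A C) (g : ver X C) (h : ver B D)
    (phi : cell J (P0 C) f g) (psi : cell H L g h) :
    cell (J +++ H) L (vid C \oo f) (vid D \oo h) :=
  comp (id1 L) (chain_cons phi (chain1 psi)).

(* phi (.) psi with phi unary, psi nullary *)
Definition odot_unary A X B C D (J : path hor A X) (H : path hor X B)
    (L : hor C D) (f : ver A C) (g : ver X D) (h : ver B D)
    (phi : cell J (P1 L) f g) (psi : cell H (P0 D) g h) :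
    cell (J +++ H) (P1 L) (vid C \oo f) (vid D \oo h) :=
  comp (idh L) (chain_cons phi (chain1 psi)).

Definition cartesian A B C D (J : path1 hor A B) (L : path1 hor C D)
    (f : ver A C) (g : ver B D) (psi : cell J L f g) : Prop :=
  forall X Y (H : path hor X Y) (h : ver X A) (k : ver Y B)
    (chi : cell H L (f \oo h) (g \oo k)),
  exists! phi : cell H J h k, chi = comp psi (chain1 phi).

Definition weakly_cocartesian A B C D (J : path hor A B) (H : hor C D)
    (f : ver A C) (g : ver B D) (phi : cell J (P1 H) f g) : Prop :=
  forall X Y (L : path1 hor X Y) (h : ver C X) (k : ver D Y)
    (chi : cell J L (h \oo f) (k \oo g)),
  exists! psi : cell (P1 H) L h k, chi = comp psi (chain1 phi).

(* [js] is the companion of [j], defined by the cartesian cell [cart], with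
   [cocart] the corresponding weakly cocartesian cell; by
   [companion_cocart_exists] below, [cocart] exists uniquely given [cart]. *)
Record is_companion A B (j : ver A B) (js : hor A B)
    (cart : cell (P1 js) (P0 B) j (vid B))
    (cocart : cell (pnil A) (P1 js) (vid A) j) : Prop := {
  companion_cart : cartesian (J := P1 js) cart;
  companion_cocart : weakly_cocartesian cocart;
  companion_vertical : cell_eq (comp cart (chain1 cocart)) (idv j);
  companion_horizontal : cell_eq (odot_unary cocart cart) (idh js)
}.

Definition weak_left_kan A B M (J : path hor A B) (d : ver A M) (l : ver B M)
    (eta : cell J (P0 M) d l) : Prop :=
  forall (k : ver B M) (phi : cell J (P0 M) d k),
  exists! phi' : vcell l k, cell_eq phi (odot eta phi').

End Notions.

(** * 2-categories and left Kan extensions in them *)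

(* Equality of elements of a doubly indexed family along equality of indices. *)
Inductive heq2 (I : Type) (X : I -> I -> Type) (i j : I) (x : X i j) :
  forall i' j' : I, X i' j' -> Prop :=
| heq2_refl : heq2 x x.

Record two_category := TwoCategory {
  ob2 :> Type;
  hom : ob2 -> ob2 -> Type;
  one : forall A, hom A A;
  comp1 : forall A B C, hom B C -> hom A B -> hom A C;
  comp1A : forall A B C D (h : hom C D) (g : hom B C) (f : hom A B),
    comp1 h (comp1 g f) = comp1 (comp1 h g) f;
  comp1_idl : forall A B (f : hom A B), comp1 (one B) f = f;
  comp1_idr : forall A B (f : hom A B), comp1 f (one A) = f;
  cell2 : forall A B, hom A B -> hom A B -> Type;
  one2 : forall A B (f : hom A B), cell2 f f;
  (* composition in the hom-categories, in diagrammatic order *)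
  comp2 : forall A B (f g h : hom A B), cell2 f g -> cell2 g h -> cell2 f h;
  comp2A : forall A B (f g h k : hom A B)
      (a : cell2 f g) (b : cell2 g h) (c : cell2 h k),
    comp2 a (comp2 b c) = comp2 (comp2 a b) c;
  comp2_idl : forall A B (f g : hom A B) (a : cell2 f g), comp2 (one2 f) a = a;
  comp2_idr : forall A B (f g : hom A B) (a : cell2 f g), comp2 a (one2 g) = a;
  (* horizontal composition *)
  hcomp : forall A B C (h k : hom B C) (f g : hom A B),
    cell2 h k -> cell2 f g -> cell2 (comp1 h f) (comp1 k g);
  hcomp_one2 : forall A B C (h : hom B C) (f : hom A B),
    hcomp (one2 h) (one2 f) = one2 (comp1 h f);
  interchange : forall A B C (h k l : hom B C) (f g e : hom A B)
      (b : cell2 h k) (b' : cell2 k l) (a : cell2 f g) (a' : cell2 g e),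
    hcomp (comp2 b b') (comp2 a a') = comp2 (hcomp b a) (hcomp b' a');
  hcompA : forall A B C D (p q : hom C D) (h k : hom B C) (f g : hom A B)
      (c : cell2 p q) (b : cell2 h k) (a : cell2 f g),
    heq2 (X := @cell2 A D) (hcomp c (hcomp b a)) (hcomp (hcomp c b) a);
  hcomp_idl : forall A B (f g : hom A B) (a : cell2 f g),
    heq2 (X := @cell2 A B) (hcomp (one2 (one B)) a) a;
  hcomp_idr : forall A B (f g : hom A B) (a : cell2 f g),
    heq2 (X := @cell2 A B) (hcomp a (one2 (one A))) a
}.

Arguments hom {t}.
Arguments cell2 {t A B}.
Arguments comp1 {t A B C}.
Arguments one2 {t A B}.
Arguments comp2 {t A B f g h}.
Arguments hcomp {t A B C h k f g}.

Definition left_kan (T : two_category) (A B M : T)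
    (d : hom A M) (j : hom A B) (l : hom B M)
    (eta : cell2 d (comp1 l j)) : Prop :=
  forall (k : hom B M) (phi : cell2 d (comp1 k j)),
  exists! phi' : cell2 l k, phi = comp2 eta (hcomp phi' (one2 j)).

(** * The 2-category V(K) *)

Section CellEq.
Variable K : avdc.
Implicit Types A B C D E F : K.

Definition cell_cast A B C D (J : path hor A B) (L : path1 hor C D)
    (f f' : ver A C) (g g' : ver B D) (ef : f = f') (eg : g = g')
    (phi : cell J L f g) : cell J L f' g' :=
  match ef in _ = f0, eg in _ = g0 return cell J L f0 g0 with
  | eq_refl, eq_refl => phi
  end.

Lemma cell_cast_eq A B C D (J : path hor A B) (L : path1 hor C D)
    (f f' : ver A C) (g g' : ver B D) (ef : f = f') (eg : g = g')
    (phi : cell J L f g) : cell_eq (cell_cast ef eg phi) phi.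
Proof. by case: _ / ef; case: _ / eg. Qed.

Lemma cell_eq_sym A B C D (J J' : path hor A B) (L L' : path1 hor C D)
    (f f' : ver A C) (g g' : ver B D)
    (phi : cell J L f g) (phi' : cell J' L' f' g') :
  cell_eq phi phi' -> cell_eq phi' phi.
Proof. by case. Qed.

Lemma cell_eq_trans A B C D (J J' J'' : path hor A B) (L L' L'' : path1 hor C D)
    (f f' f'' : ver A C) (g g' g'' : ver B D) (phi : cell J L f g)
    (phi' : cell J' L' f' g') (phi'' : cell J'' L'' f'' g'') :
  cell_eq phi phi' -> cell_eq phi' phi'' -> cell_eq phi phi''.
Proof. by move=> H H'; case: H' H. Qed.

Lemma cell_eq_ind_dep A B C D (J J' : path hor A B) (L L' : path1 hor C D)
    (f f' : ver A C) (g g' : ver B D)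
    (phi : cell J L f g) (phi' : cell J' L' f' g')
    (P : forall J L (f : ver A C) (g : ver B D), cell J L f g -> Prop) :
  cell_eq phi phi' -> P J L f g phi -> P J' L' f' g' phi'.
Proof. by case. Qed.

Lemma cell_eq_eq A B C D (J : path hor A B) (L : path1 hor C D)
    (f : ver A C) (g : ver B D) (phi phi' : cell J L f g) :
  cell_eq phi phi' -> phi = phi'.
Proof.
move=> H.
have := @cell_eq_ind_dep _ _ _ _ _ _ _ _ _ _ _ _ _ _
  (fun J' L' f' g' phi' => forall (eJ : J' = J) (eL : L' = L)
     (ef : f' = f) (eg : g' = g),
     phi = match eJ in _ = J0, eL in _ = L0, ef in _ = f0, eg in _ = g0
           return cell J0 L0 f0 g0 with
           | eq_refl, eq_refl, eq_refl, eq_refl => phi' end) H.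
move=> /(_ _ eq_refl eq_refl eq_refl eq_refl); apply=> eJ eL ef eg.
by rewrite (UIP_refl _ _ eJ) (UIP_refl _ _ eL) (UIP_refl _ _ ef) (UIP_refl _ _ eg).
Qed.

Lemma cell_eq_bd A B C D (J J' : path hor A B) (L L' : path1 hor C D)
    (f f' : ver A C) (g g' : ver B D)
    (phi : cell J L f g) (phi' : cell J' L' f' g') :
  cell_eq phi phi' -> [/\ J = J', L = L', f = f' & g = g'].
Proof. by case. Qed.

Inductive chain_eq A B C D (J : path hor A B) (L : path hor C D)
    (f : ver A C) (g : ver B D) (Phi : chain J L f g) :
  forall (J' : path hor A B) (L' : path hor C D)
    (f' : ver A C) (g' : ver B D), chain J' L' f' g' -> Prop :=
| chain_eq_refl : chain_eq Phi Phi.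

Lemma chain_eq_ind_dep A B C D (J J' : path hor A B) (L L' : path hor C D)
    (f f' : ver A C) (g g' : ver B D)
    (phi : chain J L f g) (phi' : chain J' L' f' g')
    (P : forall J L (f : ver A C) (g : ver B D), chain J L f g -> Prop) :
  chain_eq phi phi' -> P J L f g phi -> P J' L' f' g' phi'.
Proof. by case. Qed.

Lemma chain_eq_eq A B C D (J : path hor A B) (L : path hor C D)
    (f : ver A C) (g : ver B D) (phi phi' : chain J L f g) :
  chain_eq phi phi' -> phi = phi'.
Proof.
move=> H.
have := @chain_eq_ind_dep _ _ _ _ _ _ _ _ _ _ _ _ _ _
  (fun J' L' f' g' phi' => forall (eJ : J' = J) (eL : L' = L)
     (ef : f' = f) (eg : g' = g),
     phi = match eJ in _ = J0, eL in _ = L0, ef in _ = f0, eg in _ = g0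
           return chain J0 L0 f0 g0 with
           | eq_refl, eq_refl, eq_refl, eq_refl => phi' end) H.
move=> /(_ _ eq_refl eq_refl eq_refl eq_refl); apply=> eJ eL ef eg.
by rewrite (UIP_refl _ _ eJ) (UIP_refl _ _ eL) (UIP_refl _ _ ef) (UIP_refl _ _ eg).
Qed.

Lemma chain_eq_bd A B C D (J J' : path hor A B) (L L' : path hor C D)
    (f f' : ver A C) (g g' : ver B D)
    (phi : chain J L f g) (phi' : chain J' L' f' g') :
  chain_eq phi phi' -> [/\ J = J', L = L', f = f' & g = g'].
Proof. by case. Qed.

Lemma chain1_congr A B C D (J J' : path hor A B) (L L' : path1 hor C D)
    (f f' : ver A C) (g g' : ver B D)
    (phi : cell J L f g) (phi' : cell J' L' f' g') :
  cell_eq phi phi' -> chain_eq (chain1 phi) (chain1 phi').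
Proof. by case. Qed.

Lemma chain_cons_congr A B X C D Y (J1 J1' : path hor A X)
    (L1 L1' : path1 hor C Y) (J2 J2' : path hor X B) (L2 L2' : path hor Y D)
    (f f' : ver A C) (g g' : ver X Y) (h h' : ver B D)
    (phi : cell J1 L1 f g) (phi' : cell J1' L1' f' g')
    (Phi : chain J2 L2 g h) (Phi' : chain J2' L2' g' h') :
  cell_eq phi phi' -> chain_eq Phi Phi' ->
  chain_eq (chain_cons phi Phi) (chain_cons phi' Phi').
Proof.
move=> H1 H2.
have [e1 e2 e3 e4] := cell_eq_bd H1; have [e5 e6 _ e7] := chain_eq_bd H2.
subst J1' L1' f' g' J2' L2' h'.
by rewrite (cell_eq_eq H1) (chain_eq_eq H2).
Qed.

Lemma comp_congr A B C D E F (J J' : path hor A B) (L L' : path hor C D)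
    (M M' : path1 hor E F) (f f' : ver A C) (g g' : ver B D)
    (h h' : ver C E) (k k' : ver D F)
    (psi : cell L M h k) (psi' : cell L' M' h' k')
    (Phi : chain J L f g) (Phi' : chain J' L' f' g') :
  cell_eq psi psi' -> chain_eq Phi Phi' ->
  cell_eq (comp psi Phi) (comp psi' Phi').
Proof.
move=> H1 H2.
have [e1 e2 e3 e4] := cell_eq_bd H1; have [e5 e6 e7 e8] := chain_eq_bd H2.
subst L' M' h' k' J' f' g'.
by rewrite (cell_eq_eq H1) (chain_eq_eq H2).
Qed.

Lemma vcell_heq2 A C (f g f' g' : ver A C) (phi : vcell f g)
    (phi' : vcell f' g') :
  cell_eq phi phi' -> heq2 (X := @vcell K A C) phi phi'.
Proof.
move=> H; have [_ _ e1 e2] := cell_eq_bd H; subst f' g'.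
by rewrite (cell_eq_eq H).
Qed.

Lemma chain_cast_eq A B C D (J J' : path hor A B) (L L' : path hor C D)
    (f : ver A C) (g : ver B D) (eJ : J = J') (eL : L = L')
    (Phi : chain J L f g) : chain_eq (chain_cast eJ eL Phi) Phi.
Proof. by case: _ / eJ; case: _ / eL. Qed.

Definition vcell_comp A C (f g h : ver A C) (phi : vcell f g)
    (psi : vcell g h) : vcell f h :=
  cell_cast (vcomp_idl f) (vcomp_idl h) (odot phi psi).

Definition vcell_hcomp A C E (h k : ver C E) (f g : ver A C)
    (psi : vcell h k) (phi : vcell f g) : vcell (h \oo f) (k \oo g) :=
  comp psi (chain1 phi).

Lemma vcell_compE A C (f g h : ver A C) (phi : vcell f g) (psi : vcell g h) :
  cell_eq (vcell_comp phi psi) (odot phi psi).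
Proof. exact: cell_cast_eq. Qed.

(* psi o (id_C o (phi_1, phi_2)) = psi o (phi_1, phi_2) *)
Lemma comp_odot A C E (f g h : ver A C) (k l : ver C E)
    (psi : vcell k l) (phi1 : vcell f g) (phi2 : vcell g h) :
  cell_eq (comp psi (chain1 (vcell_comp phi1 phi2)))
          (comp psi (chain_cons phi1 (chain1 phi2))).
Proof.
pose S := stack1 (chain_cons phi1 (chain1 phi2)) (idv (vid C)).
have H := compA psi S.
apply: cell_eq_trans (cell_eq_trans H _).
  exact: comp_congr (cell_eq_refl _) (chain1_congr (vcell_compE _ _)).
apply: comp_congr; last exact: chain_eq_refl.
exact: comp_idvr.
Qed.

(* (psi_1 (.) psi_2) o (phi_1, phi_2) = (psi_1 o phi_1) (.) (psi_2 o phi_2) *)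
Lemma odot_comp A C E (f g h : ver A C) (k l m : ver C E)
    (psi1 : vcell k l) (psi2 : vcell l m)
    (phi1 : vcell f g) (phi2 : vcell g h) :
  cell_eq (comp (vcell_comp psi1 psi2) (chain_cons phi1 (chain1 phi2)))
    (odot (comp psi1 (chain1 phi1)) (comp psi2 (chain1 phi2))).
Proof.
pose S := stack_cons (chain1 phi1) psi1 (stack1 (chain1 phi2) psi2).
have H := compA (idv (vid E)) S.
apply: cell_eq_trans (cell_eq_sym H).
apply: comp_congr; first exact: vcell_compE.
exact: chain_eq_refl.
Qed.

Lemma vcell_compA A C (f g h k : ver A C)
    (a : vcell f g) (b : vcell g h) (c : vcell h k) :
  vcell_comp a (vcell_comp b c) = vcell_comp (vcell_comp a b) c.
Proof.
have idvid : cell_eq (odot (idv (vid C)) (idv (vid C))) (idv (vid C)).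
  apply: cell_eq_trans (comp_idvl (idv (vid C))).
  by apply: comp_insert_id (cell_eq_refl _); apply: insert_start.
apply: cell_eq_eq.
apply: (@cell_eq_trans _ _ _ _ _ _ _ _ _ _ _ _ _ _ _ _ _
  (comp (idv (vid C)) (chain_cons a (chain_cons b (chain1 c))))).
- pose S := stack_cons (chain1 a) (idv (vid C))
    (stack1 (chain_cons b (chain1 c)) (idv (vid C))).
  have H := compA (idv (vid C)) S.
  apply: cell_eq_trans (vcell_compE _ _) _.
  apply: cell_eq_trans (cell_eq_trans H _).
    exact: comp_congr (cell_eq_refl _) (chain_cons_congr
      (cell_eq_sym (comp_idvl a)) (chain1_congr (vcell_compE _ _))).
  by apply: comp_congr idvid _; apply: chain_eq_refl.
- pose S := stack_cons (chain_cons a (chain1 b)) (idv (vid C))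
    (stack1 (chain1 c) (idv (vid C))).
  have H := compA (idv (vid C)) S.
  apply: cell_eq_sym; apply: cell_eq_trans (vcell_compE _ _) _.
  apply: cell_eq_trans (cell_eq_trans H _).
    exact: comp_congr (cell_eq_refl _) (chain_cons_congr
      (vcell_compE _ _) (chain1_congr (cell_eq_sym (comp_idvl c)))).
  by apply: comp_congr idvid _; apply: chain_cast_eq.
Qed.

Lemma vcell_comp_idl A C (f g : ver A C) (a : vcell f g) :
  vcell_comp (idv f) a = a.
Proof.
apply: cell_eq_eq; apply: cell_eq_trans (vcell_compE _ _) _.
apply: cell_eq_trans (comp_idvl a).
by apply: comp_insert_id (cell_eq_refl _); apply: insert_start.
Qed.

Lemma vcell_comp_idr A C (f g : ver A C) (a : vcell f g) :
  vcell_comp a (idv g) = a.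
Proof.
apply: cell_eq_eq; apply: cell_eq_trans (vcell_compE _ _) _.
apply: cell_eq_trans (comp_idvl a).
by apply: comp_insert_id (cell_eq_refl _); apply: insert_end.
Qed.

Lemma vcell_interchange A C E (h k l : ver C E) (f g e : ver A C)
    (b : vcell h k) (b' : vcell k l) (a : vcell f g) (a' : vcell g e) :
  vcell_hcomp (vcell_comp b b') (vcell_comp a a')
  = vcell_comp (vcell_hcomp b a) (vcell_hcomp b' a').
Proof.
apply: cell_eq_eq; apply: cell_eq_trans (comp_odot _ _ _) _.
apply: cell_eq_trans (odot_comp _ _ _ _) _.
exact: cell_eq_sym (vcell_compE _ _).
Qed.

Lemma vcell_hcompA A B C D (p q : ver C D) (h k : ver B C) (f g : ver A B)
    (c : vcell p q) (b : vcell h k) (a : vcell f g) :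
  heq2 (X := @vcell K A D)
    (vcell_hcomp c (vcell_hcomp b a)) (vcell_hcomp (vcell_hcomp c b) a).
Proof. exact: vcell_heq2 (compA c (stack1 (chain1 a) b)). Qed.

Definition vertical_two_category : two_category := {|
  ob2 := ob K;
  hom := @ver K;
  one := @vid K;
  comp1 := @vcomp K;
  comp1A := @vcompA K;
  comp1_idl := @vcomp_idl K;
  comp1_idr := @vcomp_idr K;
  cell2 := @vcell K;
  one2 := @idv K;
  comp2 := vcell_comp;
  comp2A := vcell_compA;
  comp2_idl := vcell_comp_idl;
  comp2_idr := vcell_comp_idr;
  hcomp := vcell_hcomp;
  hcomp_one2 := @idv_comp K;
  interchange := vcell_interchange;
  hcompA := vcell_hcompA;
  hcomp_idl := fun A B f g a => vcell_heq2 (comp_idvl a);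
  hcomp_idr := fun A B f g a => vcell_heq2 (comp_idvr a)
|}.

End CellEq.

Section Companion.
Variable K : avdc.
Implicit Types A B X Y : K.

(* A cartesian cell [cart] alone determines its companion structure, so the
   other conditions of [is_companion] put no restriction on [js]. *)
Lemma companion_cocart_exists A B (j : ver A B) (js : hor A B)
    (cart : cell (P1 js) (P0 B) j (vid B)) :
  cartesian (J := P1 js) cart -> exists! cocart, is_companion cart cocart.
Proof.
move=> Hc.
pose chi := cell_cast (esym (vcomp_idr j)) (esym (vcomp_idl j)) (idv j).
have Hchi : cell_eq chi _ := cell_cast_eq _ _ _.
have [c [E U]] := Hc _ _ _ _ _ chi.
have Ec : cell_eq (comp cart (chain1 c)) (idv j) by rewrite -E.
exists c; split; last first.
  move=> c' [_ _ V _]; apply: U; apply: cell_eq_eq.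
  exact: cell_eq_trans Hchi (cell_eq_sym V).
have Hor : cell_eq (odot_unary c cart) (idh js).
  pose x := cell_cast (vcomp_idl (vid A)) (vcomp_idl (vid B)) (odot_unary c cart).
  have Hx : cell_eq x _ := cell_cast_eq _ _ _.
  apply: cell_eq_trans (cell_eq_sym Hx) _.
  have [z [_ Uz]] := Hc _ _ _ _ _ (comp cart (chain1 (idh js))).
  suff : cell_eq (comp cart (chain1 x)) (comp cart (chain1 (idh js))).
    move/cell_eq_eq=> E'.
    rewrite -(Uz (x : cell (P1 js) (P1 js) _ _)) ?(Uz (idh js)) //; exact: cell_eq_refl.
  have H1 : cell_eq (comp cart (chain1 (idh js))) cart := comp_idhr (Js := pnil B) cart.
  apply: cell_eq_trans (cell_eq_sym H1).
  pose S := stack1 (chain_cons c (chain1 cart)) (idh js).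
  have H2 := compA cart S.
  have H2' : cell_eq (comp cart (chain1 x)) (comp cart (chain_cons c (chain1 cart))).
    apply: cell_eq_trans (cell_eq_trans H2 _).
      exact: comp_congr (cell_eq_refl _) (chain1_congr Hx).
    exact: comp_congr H1 (chain_eq_refl _).
  apply: cell_eq_trans H2' _.
  pose S2 := stack_cons (chain1 c) cart (stack1 (chain1 cart) (idv (vid B))).
  have H3 := compA (idv (vid B)) S2.
  have H4 : cell_eq (odot cart (idv (vid B))) cart.
    apply: cell_eq_trans (comp_idvl cart).
    apply: comp_insert_id (cell_eq_refl _). exact: insert_end.
  apply: cell_eq_trans (cell_eq_trans (cell_eq_sym H3) _).
    exact: comp_congr (cell_eq_sym H4) (chain_eq_refl _).
  apply: (@cell_eq_trans _ _ _ _ _ _ _ _ _ _ _ _ _ _ _ _ _ _ (comp (idv (vid B)) (chain_cons (idv j) (chain1 cart)))).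
    exact: comp_congr (cell_eq_refl _) (chain_cons_congr Ec (chain1_congr (comp_idvl _))).
  apply: cell_eq_trans (comp_idvl cart).
  apply: comp_insert_id (cell_eq_refl _). exact: insert_start.
have wc : weakly_cocartesian c.
{ move=> X Y L h k psi.
  pose kc := comp (idv k) (chain1 cart).
  have [i Hi] : exists i : cell (L +++ pnil Y) L (vid X) (vid Y), cell_eq i (id1 L).
    by clear -L; case: L => [Z|Z W J]; eexists; apply: cell_eq_refl.
  pose r := comp i (chain_cons psi (chain1 kc)).
  have idL A' B' (P : path (@hor K) A' B') (f : ver A' X) (g : ver B' Y)
     (a : cell P L f g) : cell_eq (comp (id1 L) (chain1 a)) a.
    clear -a; case: L f g a => [Z|Z W J] f g a; [exact: comp_idvl|exact: comp_idhl].
  have idR A' B' (P : path (@hor K) A' B') (f : ver A' X) (g : ver B' Y)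
     (a : cell P L f g) : cell_eq (comp i (chain_cons a (chain1 (idv g)))) a.
    apply: cell_eq_trans (idL _ _ _ _ _ a).
    by apply: comp_insert_id Hi; apply: insert_end.
  have e1 : vid X \oo (h \oo vid A) = h by rewrite vcomp_idl vcomp_idr.
  have e2 : vid Y \oo (k \oo vid B) = k by rewrite vcomp_idl vcomp_idr.
  pose r' := cell_cast e1 e2 r.
  have Hr : cell_eq r' r := cell_cast_eq _ _ _.
  exists r'; split.
  - apply: cell_eq_eq; apply: cell_eq_sym.
    apply: (@cell_eq_trans _ _ _ _ _ _ _ _ _ _ _ _ _ _ _ _ _ _ (comp r (chain1 c))).
      exact: comp_congr Hr (chain_eq_refl _).
    pose S := stack_cons (chain1 (idv (vid A))) psi (stack1 (chain1 c) kc).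
    have H := compA i S.
    have H' : cell_eq (comp r (stack_top S)) (comp r (chain1 c)).
      apply: comp_insert_id (cell_eq_refl _). exact: (insert_start (@idv K) (chain1 c)).
    apply: cell_eq_trans (cell_eq_sym H') _.
    apply: cell_eq_trans (cell_eq_sym H) _.
    apply: cell_eq_trans (idR _ _ _ _ _ psi).
    apply: comp_congr (cell_eq_refl _) _.
    apply: (chain_cons_congr (comp_idvr psi)); apply: (@chain1_congr _ _ _ _ _ _ _ (P0 Y) (P0 Y)).
    rewrite -idv_comp.
    apply: cell_eq_trans (cell_eq_sym (compA (idv k) (stack1 (chain1 c) cart))) _.
    exact: comp_congr (cell_eq_refl _) (chain1_congr Ec).
  - move=> z Ez; apply: cell_eq_eq; apply: cell_eq_trans Hr _.
    pose S := stack_cons (chain1 c) z (stack1 (chain1 cart) (idv k)).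
    have H := compA i S.
    apply: (@cell_eq_trans _ _ _ _ _ _ _ _ _ _ _ _ _ _ _ _ _ _ (comp i (stack_comp (@comp K) S))).
      rewrite /r Ez; exact: cell_eq_refl.
    apply: (cell_eq_trans H).
    apply: (@cell_eq_trans _ _ _ _ _ _ _ _ _ _ _ _ _ _ _ _ _ _ (comp z (chain_cons c (chain1 cart)))).
      exact: comp_congr (idR _ _ _ _ _ z) (chain_eq_refl _).
    have H1 : cell_eq (comp z (chain1 (idh js))) z := comp_idhr (Js := pnil B) z.
    apply: (cell_eq_trans _ H1).
    pose S2 := stack1 (chain_cons c (chain1 cart)) (idh js).
    have H2 := compA z S2.
    apply: cell_eq_trans (comp_congr (cell_eq_refl _) (chain1_congr Hor)).
    apply: cell_eq_sym; apply: (cell_eq_trans H2).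
    exact: comp_congr H1 (chain_eq_refl _). }
by split.
Qed.

End Companion.

(* Main.v *)
(** Precomposition with cocart is a bijection between the nullary cells j_* => M
    with vertical source d and target k and the vertical cells d => k o j. It
    sends eta' (.) phi' to eta (.) (phi' o j), by associativity applied to the
    chain (cocart, id_j), so it identifies the two universal properties. *)
From Corelib Require Import ssreflect.
Require Import Defs.

Section Companion.
Set Implicit Arguments.
Unset Strict Implicit.
Variable K : avdc.
Implicit Types A B M : K.

(** Only the unary cell [psi] meets [cocart]; placing [idv j] above the vertical cell [phi]
    completes a stack to which [compA] applies. *)
Lemma odot_comp_unary A B M (d : ver A M) (j : ver A B) (l k : ver B M)
    (js : hor A B) (cocart : cell (pnil A) (P1 js) (vid A) j)
    (psi : cell (P1 js) (P0 M) d l) (phi : vcell l k) :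
  cell_eq (comp (odot psi phi) (chain1 cocart))
          (odot (comp psi (chain1 cocart)) (comp phi (chain1 (idv j)))).
Proof.
pose S := stack_cons (chain1 cocart) psi (stack1 (chain1 (idv j)) phi).
apply: cell_eq_trans (cell_eq_sym (compA (idv (vid M)) S)).
apply: cell_eq_sym.
apply: (comp_insert_id (Phi := chain1 cocart) (Phi' := stack_top S))
  (cell_eq_refl _).
exact: insert_end.
Qed.

Lemma weakly_cocartesian_inj A B M (d : ver A M) (j : ver A B) (k : ver B M)
    (js : hor A B) (cocart : cell (pnil A) (P1 js) (vid A) j)
    (phi psi : cell (P1 js) (P0 M) d k) :
  weakly_cocartesian cocart ->
  comp phi (chain1 cocart) = comp psi (chain1 cocart) -> phi = psi.
Proof.
move=> wc e; have [z [_ U]] := wc _ _ _ _ _ (comp phi (chain1 cocart)).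
by rewrite -(U phi) // -(U psi).
Qed.

(** Matches the factorisations one [phi'] at a time, so that existence and uniqueness both transfer
    between the two universal properties. *)
Lemma factorisation_iff A B M (d : ver A M) (j : ver A B) (l k : ver B M)
    (eta : vcell d (l \oo j)) (js : hor A B)
    (cocart : cell (pnil A) (P1 js) (vid A) j)
    (eta' : cell (P1 js) (P0 M) d l) (phi : cell (P1 js) (P0 M) d k)
    (chi : vcell d (k \oo j))
    (phi' : vcell l k) :
  weakly_cocartesian cocart ->
  cell_eq eta (comp eta' (chain1 cocart)) ->
  cell_eq chi (comp phi (chain1 cocart)) ->
  chi = vcell_comp eta (vcell_hcomp phi' (idv j)) <->
  cell_eq phi (odot eta' phi').
Proof.
move=> wc Heta Hchi.
(* The cast strips [vid M] from both vertical boundaries, so that [psi] and [phi] have the same type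
   and injectivity applies. *)
pose psi : cell (P1 js) (P0 M) d k :=
  cell_cast (vcomp_idl d) (vcomp_idl k) (odot eta' phi').
have Hpsi : cell_eq psi (odot eta' phi') := cell_cast_eq _ _ _.
have Hcomp : cell_eq (comp psi (chain1 cocart))
    (vcell_comp eta (vcell_hcomp phi' (idv j))).
  apply: cell_eq_trans (comp_congr Hpsi (chain_eq_refl _)) _.
  apply: cell_eq_trans (odot_comp_unary cocart eta' phi') _.
  apply: cell_eq_trans (cell_eq_sym (vcell_compE _ _)).
  exact: comp_congr (cell_eq_refl _)
    (chain_cons_congr (cell_eq_sym Heta) (chain_eq_refl _)).
split=> [e|H].
- suff -> : phi = psi by [].
  apply: weakly_cocartesian_inj wc _; apply: cell_eq_eq.
  apply: cell_eq_trans (cell_eq_sym Hchi) _.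
  by rewrite e; apply: cell_eq_sym.
- have e : psi = phi := cell_eq_eq (cell_eq_trans Hpsi (cell_eq_sym H)).
  apply: cell_eq_eq; apply: cell_eq_trans Hchi _.
  by rewrite -e.
Qed.

End Companion.

Theorem proposition4p3 (K : avdc) (A B M : K)
    (d : ver A M) (j : ver A B) (l : ver B M) (eta : vcell d (l \oo j))
    (js : hor A B) (cart : cell (P1 js) (P0 B) j (vid B))
    (cocart : cell (pnil A) (P1 js) (vid A) j)
    (Hjs : is_companion cart cocart)
    (eta' : cell (P1 js) (P0 M) d l)
    (Heta' : cell_eq eta (comp eta' (chain1 cocart))) :
  left_kan (T := vertical_two_category K) eta <-> weak_left_kan eta'.
Proof.
have wc := companion_cocart Hjs.
split=> kan k x.
(* The vertical cell corresponding to [x], with source [d \oo vid A] cast to [d]. *)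
- pose chi : vcell d (k \oo j) :=
    cell_cast (vcomp_idr d) (eq_refl _) (comp x (chain1 cocart)).
  have Hchi : cell_eq chi (comp x (chain1 cocart)) := cell_cast_eq _ _ _.
  have [z [Hz U]] := kan k chi.
  exists z; split=> [|z' Hz'].
    exact: (proj1 (factorisation_iff z wc Heta' Hchi)).
  exact: U (proj2 (factorisation_iff z' wc Heta' Hchi) Hz').
(* Conversely, every vertical cell [x] arises from some [phi] because [cocart] is weakly
   cocartesian. *)
- have [phi [Hphi _]] := wc _ _ (P0 M) d k
    (cell_cast (eq_sym (vcomp_idr d)) (eq_refl _) x).
  have Hx : cell_eq x (comp phi (chain1 cocart)).
    by rewrite -Hphi; apply: cell_eq_sym; apply: cell_cast_eq.
  have [z [Hz U]] := kan k phi.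
  exists z; split=> [|z' Hz'].
    exact: (proj2 (factorisation_iff z wc Heta' Hx)).
  exact: U (proj1 (factorisation_iff z' wc Heta' Hx) Hz').
Qed.
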